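(* Let $S$ be a non-empty set of places of $\mathbb{Q}$. Then the image of $C_{\mathbb{Q}}$ in $\mathbb{A}_{\mathbb{Q}}^S=\prod'_{v\notin S}\mathbb{Q}_v$ under the diagonal embedding $C_{\mathbb{Q}}\hookrightarrow \mathbb{A}_{\mathbb{Q}}^S$ is dense.
   Context: $C_{\mathbb{Q}}$ denotes the set of rational numbers $r$ of the form $r=\alpha^3+\beta^3$ with $\alpha,\beta\in\mathbb{Q}$. $\mathbb{A}_{\mathbb{Q}}^S$ is the ring of adeles of $\mathbb{Q}$ away from $S$, i.e. the restricted product of the completions $\mathbb{Q}_v$ over places $v\notin S$ (with $\mathbb{Q}_\infty=\mathbb{R}$) with respect to the subrings $\mathbb{Z}_p$ at the finite places $p\notin S$, with the restricted product topology. *)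

(* Defs.v *)
From HB Require Import structures.
From mathcomp Require Import all_boot all_order all_algebra.
From mathcomp Require Import generic_quotient ring_quotient.
From mathcomp Require Import all_classical all_reals.
From mathcomp Require Import topology normedtype.
From mathcomp Require Import zify ring lra.

Set Implicit Arguments.
Unset Strict Implicit.
Unset Printing Implicit Defensive.

Import Order.TTheory GRing.Theory Num.Theory.
Import numFieldNormedType.Exports.
Local Open Scope classical_set_scope.
Local Open Scope ring_scope.

Definition prime_nat := {p : nat | prime p}.

Section PadicNorm.
Variable p : prime_nat.

Definition padic_val (x : rat) : int :=
  (logn (val p) `|numq x|%N)%:Z - (logn (val p) `|denq x|%N)%:Z.

Definition padic_norm (x : rat) : rat :=
  if x == 0 then 0 else (val p)%:R ^ (- padic_val x).

Local Notation nrm := padic_norm.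

Let p_gt0 : 0 < (val p)%:R :> rat.
Proof. by rewrite ltr0n prime_gt0 ?(valP p). Qed.
Let p_gt1 : 1 < (val p)%:R :> rat.
Proof. by rewrite ltr1n prime_gt1 ?(valP p). Qed.

Lemma padic_norm0 : nrm 0 = 0. Proof. by rewrite /nrm eqxx. Qed.

Lemma padic_norm_gt0 x : x != 0 -> 0 < nrm x.
Proof. by move=> x0; rewrite /nrm (negbTE x0) exprz_gt0. Qed.

Lemma padic_norm_ge0 x : 0 <= nrm x.
Proof.
by have [->|/padic_norm_gt0/ltW//] := eqVneq x 0; rewrite padic_norm0.
Qed.

Lemma padic_val_frac (a b : int) : a != 0 -> b != 0 ->
  padic_val (a%:~R / b%:~R) =
  (logn (val p) `|a|%N)%:Z - (logn (val p) `|b|%N)%:Z.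
Proof.
move=> a0 b0; set x : rat := _ / _.
have x0 : x != 0 by rewrite mulf_neq0 ?invr_eq0 ?intr_eq0.
have n0 : numq x != 0 by rewrite numq_eq0.
have E : (numq x * b = a * denq x)%R.
  apply/eqP; rewrite -(eqr_int rat) !rmorphM /=.
  rewrite -[X in _ == _ * X]/((denq x)%:~R) numqE mulrAC -/x.
  by rewrite /x divfK ?intr_eq0.
have /(congr1 (fun z => logn (val p) `|z|%N)) := E.
rewrite !abszM !lognM ?absz_gt0 ?denq_neq0// /padic_val.
by do 4!move: (logn _ _) => ?; lia.
Qed.

Lemma padic_norm_frac (a b : int) : a != 0 -> b != 0 ->
  nrm (a%:~R / b%:~R) =
  (val p)%:R ^ ((logn (val p) `|b|%N)%:Z - (logn (val p) `|a|%N)%:Z).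
Proof.
move=> a0 b0; rewrite /nrm padic_val_frac// opprB.
by rewrite mulf_eq0 invr_eq0 !intr_eq0 (negbTE a0) (negbTE b0).
Qed.

Lemma padic_normM x y : nrm (x * y) = nrm x * nrm y.
Proof.
have [->|x0] := eqVneq x 0; first by rewrite mul0r padic_norm0 mul0r.
have [->|y0] := eqVneq y 0; first by rewrite mulr0 padic_norm0 mulr0.
rewrite -{1}(divq_num_den x) -{1}(divq_num_den y) mulf_div -!rmorphM /=.
rewrite padic_norm_frac ?mulf_neq0 ?numq_eq0 ?denq_neq0//.
rewrite /nrm (negbTE x0) (negbTE y0) -expfzDr ?gt_eqF//; congr (_ ^ _).
rewrite /padic_val !abszM !lognM ?absz_gt0 ?denq_neq0 ?numq_eq0//.
by do 4!move: (logn _ _) => ?; lia.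
Qed.

Lemma padic_norm1 : nrm 1 = 1.
Proof. by rewrite /nrm oner_eq0 /padic_val logn1 subr0 oppr0 expr0z. Qed.

Lemma padic_normN x : nrm (- x) = nrm x.
Proof. by rewrite /nrm oppr_eq0 /padic_val numqN denqN abszN. Qed.

Lemma padic_normB x y : nrm (x - y) = nrm (y - x).
Proof. by rewrite -padic_normN opprB. Qed.

Lemma padic_norm_eq0 x : (nrm x == 0) = (x == 0).
Proof.
by have [->|/padic_norm_gt0/gt_eqF//] := eqVneq x 0; rewrite padic_norm0 eqxx.
Qed.

Lemma padic_normV x : nrm x^-1 = (nrm x)^-1.
Proof.
have [->|x0] := eqVneq x 0; first by rewrite !(invr0, padic_norm0).
apply: (mulfI (x := nrm x)); first by rewrite padic_norm_eq0.
by rewrite -padic_normM !divff ?padic_norm_eq0// padic_norm1.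
Qed.

Lemma padic_normD x y : nrm (x + y) <= Num.max (nrm x) (nrm y).
Proof.
have [->|x0] := eqVneq x 0; first by rewrite add0r le_max lexx orbT.
have [->|y0] := eqVneq y 0; first by rewrite addr0 le_max lexx.
have [xy0|xy0] := eqVneq (x + y) 0.
  by rewrite xy0 padic_norm0 le_max padic_norm_ge0.
pose a := numq x * denq y; pose b := numq y * denq x; pose d := denq x * denq y.
have dx := denq_neq0 x; have dy := denq_neq0 y.
have d0 : d != 0 by rewrite mulf_neq0.
have a0 : a != 0 by rewrite mulf_neq0 ?numq_eq0.
have b0 : b != 0 by rewrite mulf_neq0 ?numq_eq0.
have ex : x = a%:~R / d%:~R.
  by rewrite /a /d !rmorphM /= -mulf_div divff ?intr_eq0// mulr1 divq_num_den.
have ey : y = b%:~R / d%:~R.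
  rewrite /b /d !rmorphM /= [X in _ / X]mulrC -mulf_div divff ?intr_eq0//.
  by rewrite mulr1 divq_num_den.
have exy : x + y = (a + b)%:~R / d%:~R by rewrite ex ey -mulrDl rmorphD.
have ab0 : a + b != 0.
  by apply: contra_neq xy0 => ab; rewrite exy ab mul0r.
rewrite exy ex ey !padic_norm_frac// le_max !ler_eXz2l//.
set k := minn (logn (val p) `|a|%N) (logn (val p) `|b|%N).
suff : (k <= logn (val p) `|(a + b)%R|%N)%N by by rewrite /k; do 3!move: (logn _ _) => ?; lia.
rewrite -pfactor_dvdn ?(valP p) ?absz_gt0//.
have : ((val p ^ k)%N%:Z %| a + b)%Z.
  by apply: rpredD; rewrite /= dvdzE /= pfactor_dvdn ?(valP p) ?absz_gt0//;
    rewrite /k ?geq_minl ?geq_minr.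
by rewrite dvdzE.
Qed.

Lemma padic_normD_lt x y e : nrm x < e -> nrm y < e -> nrm (x + y) < e.
Proof.
by move=> xe ye; apply: (le_lt_trans (padic_normD _ _)); rewrite gt_max xe ye.
Qed.

Lemma padic_normB_lt x y e : nrm x < e -> nrm y < e -> nrm (x - y) < e.
Proof. by move=> xe ye; apply: padic_normD_lt; rewrite ?padic_normN. Qed.

Lemma padic_norm_eq x y : nrm (x - y) < nrm y -> nrm x = nrm y.
Proof.
move=> xy; apply/le_anti/andP; split.
  rewrite -[x in nrm x](subrK y); apply: (le_trans (padic_normD _ _)).
  by rewrite ge_max lexx (ltW xy).
rewrite leNgt; apply/negP => xly.
have := padic_normB_lt xly xy; rewrite opprB addrCA subrr addr0.
by rewrite ltxx.
Qed.

End PadicNorm.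

Section PadicCauchy.
Variable p : prime_nat.
Local Notation nrm := (padic_norm p).

Definition is_padic_cauchy (u : nat -> rat) : Prop :=
  forall e : rat, 0 < e -> exists N : nat, forall m n : nat,
    (N <= m)%N -> (N <= n)%N -> padic_norm p (u m - u n) < e.

Definition is_padic_null (u : nat -> rat) : Prop :=
  forall e : rat, 0 < e -> exists N : nat, forall n : nat,
    (N <= n)%N -> padic_norm p (u n) < e.

Lemma padic_cauchy_bounded u : is_padic_cauchy u ->
  exists2 M : rat, 0 < M &
    exists N : nat, forall n, (N <= n)%N -> nrm (u n) < M.
Proof.
move=> /(_ 1 ltr01)[N uN]; exists (nrm (u N) + 1).
  by rewrite ltr_wpDl ?padic_norm_ge0.
exists N => n Nn; rewrite -[u n](subrK (u N)).
have h := padic_norm_ge0 p (u N).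
by apply: padic_normD_lt; [apply: (lt_le_trans (uN _ _ Nn (leqnn _)))|]; lra.
Qed.

Definition padic_cauchy : pred (nat -> rat) := fun u => `[< is_padic_cauchy u >].

Lemma padic_cauchy_subring : subring_closed padic_cauchy.
Proof.
split.
- apply/asboolP => e e0; exists 0%N => m n _ _.
  by rewrite subrr padic_norm0.
- move=> u v /asboolP cu /asboolP cv; apply/asboolP => e e0.
  have [N uN] := cu e e0; have [M vM] := cv e e0.
  exists (maxn N M) => m n; rewrite !geq_max => /andP[Nm Mm] /andP[Nn Mn].
  rewrite [X in nrm X](_ : _ = (u m - u n) - (v m - v n)); last first.
    by rewrite !fctE; ring.
  by apply: padic_normB_lt; [exact: uN|exact: vM].
- move=> u v /asboolP cu /asboolP cv; apply/asboolP => e e0.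
  have [A A0 [N0 uA]] := padic_cauchy_bounded cu.
  have [B B0 [M0 vB]] := padic_cauchy_bounded cv.
  have [N uN] := cu _ (divr_gt0 e0 B0); have [M vM] := cv _ (divr_gt0 e0 A0).
  exists (maxn (maxn N M) (maxn N0 M0)) => m n.
  rewrite !geq_max => /andP[/andP[h1 h2] /andP[h3 h4]].
  move=> /andP[/andP[k1 k2] /andP[k3 k4]].
  rewrite [X in nrm X](_ : _ = u m * (v m - v n) + (u m - u n) * v n); last first.
    by rewrite !fctE; ring.
  apply: padic_normD_lt; rewrite padic_normM.
    rewrite -(divfK (lt0r_neq0 A0) e) mulrC.
    by apply: ltr_pM; rewrite ?padic_norm_ge0 ?vM ?uA.
  rewrite -(divfK (lt0r_neq0 B0) e).
  by apply: ltr_pM; rewrite ?padic_norm_ge0 ?uN ?vB.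
Qed.

HB.instance Definition _ :=
  GRing.isSubringClosed.Build (nat -> rat) padic_cauchy padic_cauchy_subring.

End PadicCauchy.

Definition padic_seq (p : prime_nat) := {u : nat -> rat | padic_cauchy p u}.

HB.instance Definition _ (p : prime_nat) := SubChoice.on (padic_seq p).
HB.instance Definition _ (p : prime_nat) :=
  [SubChoice_isSubComNzRing of padic_seq p by <:].

Section PadicQuotient.
Variable p : prime_nat.
Local Notation nrm := (padic_norm p).

Lemma padic_seqP (u : padic_seq p) : is_padic_cauchy p (val u).
Proof. exact/asboolP/(valP u). Qed.

Definition padic_null : pred (padic_seq p) :=
  fun u => `[< is_padic_null p (val u) >].

Lemma padic_null_ideal : idealr_closed padic_null.
Proof.
split.
- by apply/asboolP => e e0; exists 0%N => n _; rewrite padic_norm0.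
- apply/negP => /asboolP/(_ 1 ltr01)[N /(_ N (leqnn N))].
  by rewrite padic_norm1 ltxx.
- move=> a u v /asboolP nu /asboolP nv; apply/asboolP => e e0.
  have [A A0 [M aA]] := padic_cauchy_bounded (padic_seqP a).
  have [N uN] := nu _ (divr_gt0 e0 A0); have [N' vN] := nv _ e0.
  exists (maxn M (maxn N N')) => n; rewrite !geq_max => /and3P[h1 h2 h3].
  rewrite [X in nrm X](_ : _ = val a n * val u n + val v n)//.
  apply: padic_normD_lt; last exact: vN.
  rewrite padic_normM -(divfK (lt0r_neq0 A0) e) mulrC.
  by apply: ltr_pM; rewrite ?padic_norm_ge0 ?uN ?aA.
Qed.

HB.instance Definition _ :=
  isIdealr.Build (padic_seq p) padic_null padic_null_ideal.

End PadicQuotient.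

(* Q_p as the ring of p-adic Cauchy sequences of rationals modulo the ideal of
   null sequences. *)
Definition padic (p : prime_nat) := {ideal_quot (@padic_null p : idealr (padic_seq p))}.

HB.instance Definition _ (p : prime_nat) := GRing.ComNzRing.on (padic p).

Section PadicField.
Variable p : prime_nat.
Local Notation nrm := (padic_norm p).
Local Open Scope quotient_scope.

Lemma padic_eq0 (u : padic_seq p) :
  (\pi_(padic p) u == 0) = (u \in @padic_null p).
Proof. by rewrite -[0](rmorph0 (\pi_(padic p))) -Quotient.idealrBE subr0. Qed.

Lemma padic_reprE (x : padic p) : \pi_(padic p) (repr x) = x.
Proof. exact: reprK. Qed.

Lemma padic_seq_away (u : padic_seq p) : u \notin @padic_null p ->
  exists2 c : rat, 0 < c &
    exists N : nat, forall n, (N <= n)%N -> nrm (val u n) = c.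
Proof.
move=> /negP nu; apply: contrapT => H; apply: nu; apply/asboolP => e e0.
have [N uN] := padic_seqP u e0; exists N => n Nn; rewrite ltNge; apply/negP.
move=> en; apply: H; exists (nrm (val u n)); first exact: lt_le_trans en.
exists N => m Nm; apply: padic_norm_eq; apply: lt_le_trans en.
exact: uN.
Qed.

Lemma padic_has_inverse (x : padic p) : x != 0 -> exists y, y * x = 1.
Proof.
rewrite -[x]padic_reprE padic_eq0 => /padic_seq_away[c c0 [N uN]].
set u := repr x in uN *.
pose v n := (val u n)^-1.
have cv : padic_cauchy p v.
  apply/asboolP => e e0.
  have [M uM] := padic_seqP u (mulr_gt0 (mulr_gt0 e0 c0) c0).
  exists (maxn N M) => m n; rewrite !geq_max => /andP[Nm Mm] /andP[Nn Mn].
  have um : val u m != 0 by rewrite -(padic_norm_eq0 p) uN ?gt_eqF.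
  have un : val u n != 0 by rewrite -(padic_norm_eq0 p) uN ?gt_eqF.
  have -> : v m - v n = (val u n - val u m) * (val u m)^-1 * (val u n)^-1.
    by rewrite /v; field; rewrite um un.
  by rewrite !padic_normM !padic_normV !uN// !ltr_pdivrMr// uM.
exists (\pi_(padic p) (exist _ v cv : padic_seq p)).
apply/eqP; rewrite -rmorphM -subr_eq0 -(rmorph1 (\pi_(padic p))) -rmorphB.
rewrite padic_eq0; apply/asboolP => e e0; exists N => n Nn.
rewrite [X in nrm X](_ : _ = v n * val u n - 1)//.
by rewrite /v mulVf ?subrr ?padic_norm0// -(padic_norm_eq0 p) uN ?gt_eqF.
Qed.

Definition padic_inv (x : padic p) : padic p := xget 0 [set y | y * x = 1].

Lemma padic_mulVf (x : padic p) : x != 0 -> padic_inv x * x = 1.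
Proof.
by move=> /padic_has_inverse xV; rewrite /padic_inv; case: xgetP => // /(_ _)/=;
  case: xV => y yx /(_ y).
Qed.

Lemma padic_inv0 : padic_inv 0 = 0.
Proof.
rewrite /padic_inv; case: xgetP => //= y _ /eqP.
by rewrite mulr0 eq_sym oner_eq0.
Qed.

HB.instance Definition _ :=
  GRing.ComNzRing_isField.Build (padic p) padic_mulVf padic_inv0.

End PadicField.

Section PadicAbs.
Variable p : prime_nat.
Local Notation nrm := (padic_norm p).
Local Open Scope quotient_scope.

(* The limit of |u_n|_p, for (u_n) representing x; it exists by padic_absP and
   is rational, the p-adic absolute value being discrete away from 0. *)
Definition padic_abs (x : padic p) : rat :=
  xget 0 [set c | forall e : rat, 0 < e -> exists N : nat, forall n : nat,
    (N <= n)%N -> `|padic_norm p (val (repr x) n) - c| < e].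

Local Notation abs := padic_abs.

Let cvg_unique (u : nat -> rat) (c d : rat) :
  (forall e : rat, 0 < e -> exists N : nat, forall n, (N <= n)%N ->
     `|nrm (u n) - c| < e) ->
  (forall e : rat, 0 < e -> exists N : nat, forall n, (N <= n)%N ->
     `|nrm (u n) - d| < e) -> c = d.
Proof.
move=> uc ud; apply/eqP; rewrite -subr_eq0 -normr_le0 leNgt; apply/negP => cd.
have cd2 : 0 < `|c - d| / 2 by rewrite divr_gt0.
have [N uN] := uc _ cd2; have [M uM] := ud _ cd2.
have h1 := uN _ (leq_maxl N M); have h2 := uM _ (leq_maxr N M).
have := ler_distD (nrm (u (maxn N M))) c d.
rewrite leNgt [`|c - nrm _|]distrC => /negP; apply.
by rewrite [ltRHS]splitr ltrD.
Qed.

Lemma padic_absP (u : padic_seq p) :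
  (u \in @padic_null p) && (abs (\pi u) == 0) \/
  0 < abs (\pi u) /\
    exists N : nat, forall n, (N <= n)%N -> nrm (val u n) = abs (\pi u).
Proof.
set x := \pi u; set r := repr x.
have xr : x = \pi_(padic p) r by rewrite padic_reprE.
have ur : u - r \in @padic_null p by rewrite -padic_eq0 rmorphB /= -xr subrr.
have [nu|nu] := boolP (u \in @padic_null p).
  left; have nr : r \in @padic_null p by rewrite -padic_eq0 -xr /x padic_eq0.
  apply/eqP; rewrite /abs; case: xgetP => //= c _ cP.
  apply: (cvg_unique cP) => e e0; move/asboolP : nr => /(_ e e0)[N rN].
  by exists N => n Nn; rewrite subr0 ger0_norm ?padic_norm_ge0// rN.
right; have [c c0 [N uN]] := padic_seq_away nu.
have [M rM] : exists N : nat, forall n, (N <= n)%N -> nrm (val r n) = c.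
  move/asboolP : ur => /(_ c c0)[M urM]; exists (maxn N M) => n.
  rewrite geq_max => /andP[Nn Mn]; rewrite -(uN n Nn).
  by apply: padic_norm_eq; rewrite padic_normB uN// urM.
suff -> : abs x = c by split => //; exists N.
have rc : forall e : rat, 0 < e -> exists N : nat, forall n, (N <= n)%N ->
    `|nrm (val r n) - c| < e.
  by move=> e e0; exists M => n Mn; rewrite rM// subrr normr0.
rewrite /abs; case: xgetP => //= [d _ dP|/(_ _ rc)//].
exact: (cvg_unique dP rc).
Qed.

Lemma padic_abs_ge0 x : 0 <= abs x.
Proof.
by rewrite -[x]padic_reprE; case: (padic_absP (repr x)) => [/andP[_ /eqP->]|[/ltW]].
Qed.

Lemma padic_abs_eq0 x : (abs x == 0) = (x == 0).
Proof.
rewrite -[x]padic_reprE padic_eq0; case: (padic_absP (repr x)) => [/andP[-> ->//]|].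
move=> [a0 [N aN]]; rewrite gt_eqF//; apply/esym/negbTE/negP => /asboolP.
move=> /(_ _ a0)[M aM]; have := aM _ (leq_maxr N M).
by rewrite aN ?leq_maxl// ltxx.
Qed.

Lemma padic_abs_lt (u : padic_seq p) (c : rat) : abs (\pi u) < c ->
  exists N : nat, forall n, (N <= n)%N -> nrm (val u n) < c.
Proof.
case: (padic_absP u) => [/andP[/asboolP nu /eqP->]|[a0 [N aN]]] ac.
  exact: nu.
by exists N => n Nn; rewrite aN.
Qed.

Lemma padic_absD x y : abs (x + y) <= Num.max (abs x) (abs y).
Proof.
rewrite leNgt gt_max; apply/negP; rewrite -[x]padic_reprE -[y]padic_reprE.
set a := repr x; set b := repr y; rewrite -rmorphD => /andP[].
move=> /padic_abs_lt[N aN] /padic_abs_lt[M bM].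
have [/andP[_ /eqP ab0]|[ab0 [K abK]]] := padic_absP (a + b).
  by have := aN _ (leqnn N); rewrite ab0 ltNge padic_norm_ge0.
have := abK _ (leq_maxl K (maxn N M)); set n := maxn K _.
move=> E; suff : nrm (val (a + b) n) < nrm (val (a + b) n) by rewrite ltxx.
by apply: padic_normD_lt; rewrite E ?aN ?bM// /n; lia.
Qed.

Lemma padic_absM x y : abs (x * y) = abs x * abs y.
Proof.
rewrite -[x]padic_reprE -[y]padic_reprE.
set a := repr x; set b := repr y; rewrite -rmorphM.
have [/andP[na /eqP a0]|[a0 [N aN]]] := padic_absP a.
  rewrite a0 mul0r; apply/eqP; rewrite padic_abs_eq0 rmorphM /= mulf_eq0.
  by rewrite padic_eq0 na.
have [/andP[nb /eqP b0]|[b0 [M bM]]] := padic_absP b.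
  rewrite b0 mulr0; apply/eqP; rewrite padic_abs_eq0 rmorphM /= mulf_eq0.
  by rewrite [X in _ || X]padic_eq0 nb orbT.
have [/andP[/asboolP nab _]|[ab0 [K abK]]] := padic_absP (a * b).
  have [K abK] := nab _ (mulr_gt0 a0 b0).
  have := abK _ (leq_maxl K (maxn N M)); set n := maxn K _.
  rewrite [X in nrm X](_ : _ = val a n * val b n)// padic_normM.
  by rewrite aN ?bM ?ltxx// /n; lia.
have := abK _ (leq_maxl K (maxn N M)); set n := maxn K _ => <-.
rewrite [X in nrm X](_ : _ = val a n * val b n)// padic_normM.
by rewrite aN ?bM// /n; lia.
Qed.

Lemma padic_absN x : abs (- x) = abs x.
Proof.
apply/eqP; rewrite -(eqrXn2 (n := 2))// ?padic_abs_ge0//.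
by rewrite !expr2 -!padic_absM mulrNN.
Qed.

Let cst_cauchy (r : rat) : padic_cauchy p (cst r).
Proof.
by apply/asboolP => e e0; exists 0%N => m n _ _; rewrite subrr padic_norm0.
Qed.

Let cst_seq (r : rat) : padic_seq p := exist _ (cst r) (cst_cauchy r).

Let of_rat (r : rat) : padic p := \pi_(padic p) (cst_seq r).

Let of_rat_zmod_morphism : zmod_morphism of_rat.
Proof.
by move=> x y; rewrite /of_rat -rmorphB; congr (\pi _); exact/val_inj.
Qed.

Let of_rat_monoid_morphism : monoid_morphism of_rat.
Proof.
split=> [|x y]; rewrite /of_rat -?(rmorph1 (\pi_(padic p))) -?rmorphM.
  by congr (\pi _); exact/val_inj.
by congr (\pi _); exact/val_inj.
Qed.

HB.instance Definition _ :=
  GRing.isZmodMorphism.Build rat (padic p) of_rat of_rat_zmod_morphism.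
HB.instance Definition _ :=
  GRing.isMonoidMorphism.Build rat (padic p) of_rat of_rat_monoid_morphism.

Let ratr_cst (r : rat) : ratr r = of_rat r.
Proof. by rewrite -(fmorph_eq_rat of_rat). Qed.

Lemma padic_abs_ratr (r : rat) : abs (ratr r) = padic_norm p r.
Proof.
rewrite ratr_cst.
rewrite /of_rat; have [/andP[+ /eqP->]|[_ [N aN]]] := padic_absP (cst_seq r).
  have [->|r0 /asboolP] := eqVneq r 0; first by rewrite padic_norm0.
  move=> /(_ _ (padic_norm_gt0 p r0))[N /(_ _ (leqnn N))].
  by rewrite ltxx.
by rewrite -(aN N).
Qed.

Definition padic_int : set (padic p) := [set x | padic_abs x <= 1].

Definition padic_dist (x y : padic p) : rat := padic_abs (x - y).

Lemma padic_distxx x : padic_dist x x = 0.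
Proof. by apply/eqP; rewrite /padic_dist subrr padic_abs_eq0. Qed.

Lemma padic_dist_positivity x y : padic_dist x y = 0 -> x = y.
Proof.
by move/eqP; rewrite /padic_dist padic_abs_eq0 subr_eq0 => /eqP.
Qed.

Lemma padic_dist_sym x y : padic_dist x y = padic_dist y x.
Proof. by rewrite /padic_dist -padic_absN opprB. Qed.

Lemma padic_dist_triangle y x z :
  padic_dist x z <= padic_dist x y + padic_dist y z.
Proof.
rewrite /padic_dist -[x - z](subrKA y); apply: le_trans (padic_absD _ _) _.
by rewrite ge_max lerDl lerDr !padic_abs_ge0.
Qed.

HB.instance Definition _ := isMetric.Build rat (padic p)
  padic_distxx padic_dist_positivity padic_dist_sym padic_dist_triangle.

End PadicAbs.

#[short(type="preTopologicalFieldType")]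
HB.structure Definition PreTopologicalField :=
  {K of Topological K & GRing.Field K}.

HB.instance Definition _ (p : prime_nat) := GRing.Field.on (padic p).

Inductive place := Infinite | Finite of prime_nat.

Definition real_completion (R : realType) : preTopologicalFieldType :=
  HB.pack_for preTopologicalFieldType (Real.sort R)
    (Topological.on (R : topologicalType)) (GRing.Field.on R).

Definition completion (R : realType) (v : place) : preTopologicalFieldType :=
  match v with
  | Infinite => real_completion R
  | Finite p => padic p
  end.

(* Taking the whole of R at the infinite place imposes no condition there. *)
Definition completion_int (R : realType) (v : place) : set (completion R v) :=
  match v with
  | Infinite => setT
  | Finite p => @padic_int p
  end.

Section RestrictedProduct.
Context {I : Type} {K : I -> topologicalType} (Z : forall i, set (K i)).

Definition restricted_product :=
  {x : forall i, K i | `[< finite_set [set i | ~ Z (x i)] >]}.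

Definition restricted_box (U : forall i, set (K i)) : set restricted_product :=
  [set x | forall i, U i (val x i)].

Definition restricted_open_family : set (forall i, set (K i)) :=
  [set U | (forall i, open (U i)) /\ finite_set [set i | U i <> @Z i]].

HB.instance Definition _ := SubChoice.on restricted_product.

(* When the Z i are open, the open boxes are stable under finite
   intersections, so that they form a base and not only a subbase. *)
HB.instance Definition _ := isSubBaseTopological.Build restricted_product
  restricted_open_family restricted_box.

End RestrictedProduct.

Lemma padic_int1 p : @padic_int p 1.
Proof. by rewrite /padic_int/= -[1](ratr_nat (padic p) 1) padic_abs_ratr padic_norm1. Qed.

Lemma padic_intB p (x y : padic p) :
  padic_int x -> padic_int y -> padic_int (x - y).
Proof.
rewrite /padic_int/= => x1 y1; apply: le_trans (padic_absD _ _) _.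
by rewrite padic_absN ge_max x1 y1.
Qed.

Lemma padic_intM p (x y : padic p) :
  padic_int x -> padic_int y -> padic_int (x * y).
Proof.
by rewrite /padic_int/= padic_absM => x1 y1; apply: mulr_ile1; rewrite ?padic_abs_ge0.
Qed.

Section Adele.
Variables (R : realType) (S : set place).

Definition adele :=
  @restricted_product (~` S) (fun v => completion R (val v))
    (fun v => @completion_int R (val v)).

HB.instance Definition _ := Topological.on adele.

Let intB v (x y : completion R v) :
  completion_int x -> completion_int y -> completion_int (x - y).
Proof. by case: v x y => //= p x y; exact: padic_intB. Qed.

Let intM v (x y : completion R v) :
  completion_int x -> completion_int y -> completion_int (x * y).
Proof. by case: v x y => //= p x y; exact: padic_intM. Qed.

Let int1 v : completion_int (1 : completion R v).
Proof. by case: v => //= p; exact: padic_int1. Qed.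

Let int0 v : completion_int (0 : completion R v).
Proof. by rewrite -(subrr 1); exact: intB. Qed.

Let prodP (x : forall v : ~` S, completion R (val v)) (y z : adele) :
  (forall v, completion_int (val y v) -> completion_int (val z v) ->
             completion_int (x v)) ->
  `[< finite_set [set v | ~ completion_int (x v)] >].
Proof.
move=> h; apply/asboolP.
have /asboolP fy := valP y; have /asboolP fz := valP z.
apply: (@sub_finite_set _ _
  ([set v | ~ completion_int (val y v)] `|` [set v | ~ completion_int (val z v)])); last first.
  by rewrite finite_setU.
move=> v /= nx; apply: contrapT => /not_orP[/contrapT yv /contrapT zv].
exact/nx/h.
Qed.

Let zero_proof :
  `[< finite_set [set v : ~` S | ~ completion_int (0 : completion R (val v))] >].
Proof.
apply/asboolP; rewrite (_ : [set v | _] = set0) ?finite_set0//.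
by apply/seteqP; split => // v /=; apply; exact: int0.
Qed.

Definition adele0 : adele := exist _ (fun v => 0) zero_proof.

Let one_proof :
  `[< finite_set [set v : ~` S | ~ completion_int (1 : completion R (val v))] >].
Proof.
apply/asboolP; rewrite (_ : [set v | _] = set0) ?finite_set0//.
by apply/seteqP; split => // v /=; apply; exact: int1.
Qed.

Definition adele1 : adele := exist _ (fun v => 1) one_proof.

Let opp_proof (x : adele) :
  `[< finite_set [set v | ~ completion_int (- (val x v : completion R (val v)))] >].
Proof.
apply: (@prodP _ x x) => v xv _; rewrite -[- _]add0r.
by apply: intB => //; exact: int0.
Qed.

Definition adele_opp (x : adele) : adele :=
  exist _ (fun v => - (val x v : completion R (val v))) (opp_proof x).

Let add_proof (x y : adele) : `[< finite_set [set v |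
  ~ completion_int ((val x v : completion R (val v)) + val y v)] >].
Proof.
apply: (@prodP _ x y) => v xv yv; rewrite -[val y v]opprK -[- val y v]add0r.
by apply: intB => //; apply: intB => //; exact: int0.
Qed.

Definition adele_add (x y : adele) : adele :=
  exist _ (fun v => (val x v : completion R (val v)) + val y v) (add_proof x y).

Let mul_proof (x y : adele) : `[< finite_set [set v |
  ~ completion_int ((val x v : completion R (val v)) * val y v)] >].
Proof. by apply: (@prodP _ x y) => v; exact: intM. Qed.

Definition adele_mul (x y : adele) : adele :=
  exist _ (fun v => (val x v : completion R (val v)) * val y v) (mul_proof x y).

Let ext (x y : adele) : (forall v, val x v = val y v) -> x = y.
Proof. by move=> xy; apply/val_inj/functional_extensionality_dep. Qed.

Let addA : associative adele_add.
Proof. by move=> x y z; apply: ext => v /=; rewrite addrA. Qed.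
Let addC : commutative adele_add.
Proof. by move=> x y; apply: ext => v /=; rewrite addrC. Qed.
Let add0 : left_id adele0 adele_add.
Proof. by move=> x; apply: ext => v /=; rewrite add0r. Qed.
Let addN : left_inverse adele0 adele_opp adele_add.
Proof. by move=> x; apply: ext => v /=; rewrite addNr. Qed.

HB.instance Definition _ := GRing.isZmodule.Build adele addA addC add0 addN.

Let mulA : associative adele_mul.
Proof. by move=> x y z; apply: ext => v /=; rewrite mulrA. Qed.
Let mulC : commutative adele_mul.
Proof. by move=> x y; apply: ext => v /=; rewrite mulrC. Qed.
Let mul1 : left_id adele1 adele_mul.
Proof. by move=> x; apply: ext => v /=; rewrite mul1r. Qed.
Let mulD : left_distributive adele_mul adele_add.
Proof. by move=> x y z; apply: ext => v /=; rewrite mulrDl. Qed.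

HB.instance Definition _ :=
  GRing.Zmodule_isComPzRing.Build adele mulA mulC mul1 mulD.

Let place_nat (v : ~` S) : nat :=
  match val v with Infinite => 0%N | Finite p => val p end.

Let place_nat_inj : injective place_nat.
Proof.
move=> [[|p] Sp] [[|q] Sq]; rewrite /place_nat/= => pq; apply/val_inj => //=.
- by have := prime_gt0 (valP q); move: pq => /= <-.
- by have := prime_gt0 (valP p); move: pq => /= ->.
- by congr Finite; exact/val_inj.
Qed.

Let diag_proof (r : rat) :
  `[< finite_set [set v : ~` S | ~ completion_int (ratr r : completion R (val v))] >].
Proof.
apply/asboolP; set N := `|denq r|%N.+1.
apply: (@sub_finite_set _ _ (place_nat @^-1` `I_N)); last first.
  by apply: finite_preimage => // v w _ _; exact: place_nat_inj.
move=> [[|p] Sp]; rewrite /place_nat/= => nint; first by case: nint.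
apply: contrapT => Np; apply: nint; rewrite /padic_int/= padic_abs_ratr.
rewrite /padic_norm; case: ifP => // _.
have /negP pd : ~ (val p %| `|denq r|)%N.
  move=> /dvdn_leq; rewrite absz_gt0 denq_neq0 => /(_ isT) pd.
  by apply: Np; rewrite /N ltnS.
rewrite /padic_val (_ : logn (val p) `|denq r|%N = 0%N); last first.
  by rewrite lognE (negbTE pd) !andbF.
rewrite subr0 -exprz_inv -exprnP exprn_ile1//.
  by rewrite invr_ge0.
by rewrite invf_le1 ?ltr0n ?prime_gt0 ?(valP p)// ler1n prime_gt0 ?(valP p).
Qed.

Definition adele_diag (r : rat) : adele :=
  exist _ (fun v => ratr r) (diag_proof r).

End Adele.

Definition sums_of_two_cubes : set rat :=
  [set r | exists a b : rat, r = a ^+ 3 + b ^+ 3].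

(* Main.v *)
From HB Require Import structures.
From mathcomp Require Import all_boot all_order all_algebra.
From mathcomp Require Import generic_quotient ring_quotient.
From mathcomp Require Import all_classical all_reals.
From mathcomp Require Import topology normedtype finmap ring lra.
Require Import Defs.

Import Order.TTheory GRing.Theory Num.Theory.
Import numFieldNormedType.Exports.

Local Open Scope classical_set_scope.

Set Implicit Arguments.
Unset Strict Implicit.
Unset Printing Implicit Defensive.

(** For rational [r] and [w <> 0] put [a = 6 r w^2 + 1/(6w)] and
    [b = 6 r w^2 - 1/(6w)].  Then [a^3 + b^3 = r + 432 r^3 w^6]
    ([sum_two_cubes_near]).  Thus every rational [r] is a limit of sums of two
    rational cubes in every completion at once: let [w] tend to [0].  At a
    prime where [r] and [w] are both integral, the sum of cubes is integral
    too, because [432] is an integer.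

    It is therefore enough to know strong approximation for [Q] away from a
    non-empty set [S] of places, applied twice.  It provides a rational [r]
    close to the given adele at the finitely many places where the open set
    imposes a condition, and integral at the other primes outside [S]
    ([strong_approx]).  It also provides a nonzero [w] as small as desired at
    the same places and integral at the other primes outside [S]
    ([small_rat]).  The combination is [two_cubes_approx].

    Strong approximation at finitely many primes is built one prime at a time
    ([padic_simult_approx]): add [n t], where [n] is an integer close to [0] at
    the primes already treated and [t], whose denominator is a power of the
    new prime, corrects the value there ([padic_approx]).  The infinite place,
    when it is outside [S], comes last: [S] then contains a prime [p], and
    adding an integral multiple of a small [w] with denominator a power of [p]
    reaches any real number. *)

(** * Sums of two cubes close to a given rational *)

Section RationalApproximation.
Local Open Scope ring_scope.

Lemma sum_two_cubes_near (r w : rat) : w != 0 ->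
  sums_of_two_cubes (r + 432 * r ^+ 3 * w ^+ 6).
Proof.
move=> w0; exists (6 * r * w ^+ 2 + (6 * w)^-1), (6 * r * w ^+ 2 - (6 * w)^-1).
by field.
Qed.

(** * The p-adic norm on integers and primes *)

Lemma padic_normX p (x : rat) n : padic_norm p (x ^+ n) = padic_norm p x ^+ n.
Proof.
elim: n => [|n IH]; first by rewrite !expr0 padic_norm1.
by rewrite !exprS padic_normM IH.
Qed.

Lemma padic_norm_int p (z : int) : z != 0 ->
  padic_norm p z%:~R = (val p)%:R ^- logn (val p) `|z|%N.
Proof.
move=> z0; rewrite /padic_norm intr_eq0 (negbTE z0) /padic_val.
by rewrite numq_int denq_int logn1 subr0 -invr_expz.
Qed.

Lemma padic_norm_int_le1 p (z : int) : padic_norm p z%:~R <= 1.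
Proof.
have [->|z0] := eqVneq z 0; first by rewrite padic_norm0.
have p1 : 1 <= (val p)%:R :> rat by rewrite ler1n prime_gt0 ?(valP p).
rewrite padic_norm_int// invf_le1 ?exprn_ege1// exprn_gt0//.
exact: lt_le_trans ltr01 p1.
Qed.

Lemma padic_norm_nat_le1 p (n : nat) : padic_norm p n%:R <= 1.
Proof. exact: (padic_norm_int_le1 p n). Qed.

Lemma prime_natr_neq0 (p : prime_nat) : (val p)%:R != 0 :> rat.
Proof. by rewrite pnatr_eq0 -lt0n prime_gt0 ?(valP p). Qed.

Lemma padic_norm_prime p : padic_norm p (val p)%:R = (val p)%:R^-1.
Proof.
have := @padic_norm_int p (val p); rewrite /= => ->.
  by rewrite logn_prime ?(valP p)// eqxx expr1.
by rewrite -(intr_eq0 rat) prime_natr_neq0.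
Qed.

Lemma padic_norm_prime_neq p q : q != p -> padic_norm q (val p)%:R = 1.
Proof.
move=> qp; have := @padic_norm_int q (val p); rewrite /= => ->.
  have /negbTE qp' : val q != val p by apply: contraNneq qp => /val_inj->.
  by rewrite logn_prime ?(valP p)//= qp' expr0 invr1.
by rewrite -(intr_eq0 rat) prime_natr_neq0.
Qed.

(** * Strong approximation *)

Lemma padic_norm_primeX_small p (e : rat) : 0 < e ->
  exists k, padic_norm p ((val p)%:R ^+ k) < e.
Proof.
move=> e0; exists (Num.truncn e^-1).+1.
have p1 := prime_gt1 (valP p).
rewrite padic_normX padic_norm_prime exprVn invf_plt ?posrE ?exprn_gt0 ?ltr0n ?prime_gt0 ?(valP p)//.
apply: lt_le_trans (truncnS_gt _) _.
by rewrite -natrX ler_nat ltnW// ltn_expl.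
Qed.

(** An integer prime to [p] is invertible modulo every power of [p]. *)
Lemma padic_invmod p (b : nat) (e : rat) : coprime (val p) b -> 0 < e ->
  exists u : int, padic_norm p (1 - b%:R * u%:~R) < e.
Proof.
move=> pb e0; have [k pk] := padic_norm_primeX_small p e0.
have cop : coprimez b%:Z (val p ^ k)%N%:Z.
  by rewrite /coprimez /gcdz /= eqz_nat -/(coprime _ _) coprime_sym coprimeXl.
have [[u v] /= uv] := coprimezP _ _ cop.
exists u.
rewrite (_ : 1 - _ = v%:~R * (val p)%:R ^+ k).
  rewrite padic_normM; apply: le_lt_trans pk.
  by rewrite ler_piMl ?padic_norm_ge0 ?padic_norm_int_le1.
have uvQ : u%:~R * b%:R + v%:~R * (val p)%:R ^+ k = 1 :> rat.
  by have := congr1 (intr : int -> rat) uv; rewrite rmorphD !rmorphM /= -natrX.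
by rewrite -[X in X - _]uvQ; ring.
Qed.

(** The rationals whose denominator is a power of [p] are [p]-adically dense
    in [Q]. *)
Lemma padic_approx p (y e : rat) : 0 < e -> exists t : rat,
  padic_norm p (y - t) < e /\ forall q, q != p -> padic_norm q t <= 1.
Proof.
move=> e0; have [->|y0] := eqVneq y 0.
  by exists 0; rewrite subrr padic_norm0.
have dn0 : (0 < `|denq y|)%N by rewrite absz_gt0 denq_neq0.
have [|b pb db] := @pfactor_coprime (val p) `|denq y| _ dn0; first exact: valP p.
set j := logn _ _ in db.
have [u ub] := padic_invmod pb (divr_gt0 e0 (padic_norm_gt0 p y0)).
have pn0 : (val p)%:R != 0 :> rat.
  by rewrite pnatr_eq0 -lt0n prime_gt0 ?(valP p).
have b0 : b%:R != 0 :> rat.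
  by rewrite pnatr_eq0; apply: contraTneq dn0 => b0; rewrite db b0.
have ey : y = (numq y)%:~R / (b%:R * (val p)%:R ^+ j).
  rewrite -natrX -natrM -db -[y in LHS]divq_num_den; congr (_ / _).
  by rewrite -[in LHS](absz_denq y).
(* The part [b] of the denominator prime to [p] is replaced by an approximate
   [p]-adic inverse [u]; the error is [y * (1 - b * u)]. *)
exists ((numq y)%:~R * u%:~R / (val p)%:R ^+ j); split.
  rewrite (_ : _ - _ = y * (1 - b%:R * u%:~R)).
    by rewrite padic_normM mulrC -ltr_pdivlMr ?padic_norm_gt0.
  by rewrite [in RHS]ey {1}ey; field; rewrite b0 expf_neq0.
move=> q qp; rewrite padic_normM padic_normV padic_normX padic_norm_prime_neq//.
by rewrite expr1n invr1 mulr1 -rmorphM padic_norm_int_le1.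
Qed.

Lemma padic_small_nat (s : seq prime_nat) (d : prime_nat -> rat) :
  (forall p, 0 < d p) ->
  exists2 n : nat, (0 < n)%N & forall p, p \in s -> padic_norm p n%:R < d p.
Proof.
move=> d0; elim: s => [|p s [n n0 ns]]; first by exists 1%N.
have [k pk] := padic_norm_primeX_small p (d0 p).
exists (n * val p ^ k)%N; first by rewrite muln_gt0 n0 expn_gt0 prime_gt0 ?(valP p).
move=> q; rewrite inE natrM natrX padic_normM => /predU1P[->|qs].
  apply: le_lt_trans pk; rewrite ler_piMl ?padic_norm_ge0//.
  exact: (padic_norm_int_le1 p n).
apply: le_lt_trans (ns q qs); rewrite ler_piMr ?padic_norm_ge0// -natrX.
exact: (padic_norm_int_le1 q (val p ^ k)%N).
Qed.

(** When [S] contains a prime [p], dividing an integer by a large power of [p]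
    makes it small at the infinite place and leaves its norms outside [S]
    unchanged; when [S] contains the infinite place, there is nothing to ask
    there. *)
Lemma small_rat (S : set place) (s : seq prime_nat) (d : prime_nat -> rat)
    (e : rat) : S !=set0 -> (forall p, p \in s -> ~ S (Finite p)) ->
  (forall p, 0 < d p) -> 0 < e ->
  exists w : rat, [/\ w != 0, forall p, p \in s -> padic_norm p w < d p,
    forall q, ~ S (Finite q) -> padic_norm q w <= 1 &
    ~ S Infinite -> `|w| < e].
Proof.
move=> S0 sS d0 e0; have [n n0 ns] := padic_small_nat s d0.
have nn0 : n%:R != 0 :> rat by rewrite pnatr_eq0 -lt0n.
have [Soo|Soo] := pselect (S Infinite).
  exists n%:R; split=> // q _; exact: (padic_norm_int_le1 q n).
case: S0 => -[//|p Sp].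
have pn0 : (val p)%:R != 0 :> rat.
  by rewrite pnatr_eq0 -lt0n prime_gt0 ?(valP p).
have np q : ~ S (Finite q) -> q != p by move=> Sq; apply: contra_notN Sq => /eqP->.
pose j := (Num.truncn (n%:R / e)).+1.
exists (n%:R / (val p)%:R ^+ j).
have H q : ~ S (Finite q) ->
    padic_norm q (n%:R / (val p)%:R ^+ j) = padic_norm q n%:R.
  move=> /np qp; rewrite padic_normM padic_normV padic_normX.
  by rewrite padic_norm_prime_neq// expr1n invr1 mulr1.
split.
- by rewrite mulf_neq0// invr_eq0 expf_neq0.
- by move=> q qs; rewrite H ?ns//; exact: sS.
- by move=> q Sq; rewrite H//; exact: (padic_norm_int_le1 q n).
- move=> _; rewrite ger0_norm ?divr_ge0 ?exprn_ge0 ?ler0n//.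
  rewrite ltr_pdivrMr ?exprn_gt0 ?ltr0n ?prime_gt0 ?(valP p)//.
  rewrite mulrC -ltr_pdivrMr//; apply: lt_le_trans (truncnS_gt _) _.
  by rewrite -natrX ler_nat ltnW// ltn_expl// prime_gt1// (valP p).
Qed.

(** Strong approximation away from the infinite place. *)
Lemma padic_simult_approx (s : seq prime_nat) (y d : prime_nat -> rat) :
  (forall p, 0 < d p) ->
  exists r : rat, (forall p, p \in s -> padic_norm p (y p - r) < d p) /\
    forall q, q \notin s -> padic_norm q r <= 1.
Proof.
move=> d0; elim: s => [|p s [r [rs rn]]].
  by exists 0.
have [ps|ps] := boolP (p \in s).
  exists r; split=> q; rewrite inE; first by move=> /predU1P[->|]; apply: rs.
  by rewrite negb_or => /andP[_]; apply: rn.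
have [n n0 ns] := padic_small_nat s d0.
have nn0 : n%:R != 0 :> rat by rewrite pnatr_eq0 -lt0n.
have [t [tp tn]] := padic_approx p ((y p - r) / n%:R) (d0 p).
have nle q := padic_norm_int_le1 q n.
exists (r + n%:R * t); split=> q; rewrite inE.
  move=> /predU1P[->|qs].
    rewrite (_ : _ - _ = n%:R * ((y p - r) / n%:R - t)); last by field.
    rewrite padic_normM; apply: le_lt_trans tp.
    by rewrite ler_piMl ?padic_norm_ge0// nle.
  have qp : q != p by apply: contraNneq ps => <-.
  rewrite opprD addrA; apply: padic_normB_lt; first exact: rs.
  rewrite padic_normM; apply: le_lt_trans (ns q qs).
  by rewrite ler_piMr ?padic_norm_ge0// tn.
rewrite negb_or => /andP[qp qs]; apply: le_trans (padic_normD _ _ _) _.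
rewrite ge_max rn//= padic_normM mulr_ile1 ?padic_norm_ge0 ?tn//.
Qed.

(** Strong approximation away from [S], the primes of [s] being given rational
    targets and the infinite place a real one. *)
Lemma strong_approx (R : realType) (S : set place) (s : seq prime_nat)
    (y d : prime_nat -> rat) (x e : R) :
  S !=set0 -> (forall p, p \in s -> ~ S (Finite p)) ->
  (forall p, 0 < d p) -> 0 < e ->
  exists r : rat, [/\ forall p, p \in s -> padic_norm p (y p - r) < d p,
    forall q, q \notin s -> ~ S (Finite q) -> padic_norm q r <= 1 &
    ~ S Infinite -> `|x - ratr r| < e].
Proof.
move=> S0 sS d0 e0.
have [r [rs rn]] := padic_simult_approx s y d0.
have [f f0 fe] : exists2 f : rat, 0 < f & ratr f < e :> R.
  have [f] := rat_in_itvoo e0; rewrite in_itv/= => /andP[f0 fe].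
  by exists f => //; rewrite -(@ltr0q R).
have [w [w0 ws wn we]] := small_rat S0 sS d0 f0.
have wR : ratr w != 0 :> R by rewrite fmorph_eq0.
(* The error at the infinite place is the fractional part of
   [(x - r) / w] times [w]. *)
pose m := Num.floor ((x - ratr r) / ratr w).
have mle q := padic_norm_int_le1 q m.
exists (r + m%:~R * w); split=> [q qs|q qs Sq|Soo].
- rewrite opprD addrA; apply: padic_normB_lt; first exact: rs.
  rewrite padic_normM; apply: le_lt_trans (ws q qs).
  by rewrite ler_piMl ?padic_norm_ge0.
- apply: le_trans (padic_normD _ _ _) _.
  by rewrite ge_max rn//= padic_normM mulr_ile1 ?padic_norm_ge0 ?wn.
- rewrite rmorphD rmorphM /= ratr_int.
  rewrite (_ : _ - _ = ratr w * ((x - ratr r) / ratr w - m%:~R)); last by field.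
  rewrite normrM; apply: le_lt_trans (lt_trans _ fe); last first.
    by rewrite -(@ltr_rat R) in we; rewrite ratr_norm in we; exact: we.
  rewrite ler_piMr//.
  have := floor_itv ((x - ratr r) / ratr w); rewrite -/m => /andP[h1 h2].
  rewrite rmorphD /= in h2; rewrite ler_norml; apply/andP; split; lra.
Qed.

(** * Simultaneous approximation by sums of two cubes *)

Lemma mul_expr_lt (F : realFieldType) (a b d : F) n : 0 <= a -> 0 <= b ->
  a < Num.min 1 (d / (b + 1)) -> b * a ^+ n.+1 < d.
Proof.
move=> a0 b0; have b1 : 0 < b + 1 by rewrite ltr_wpDl.
rewrite lt_min ltr_pdivlMr// => /andP[/ltW a1]; apply: le_lt_trans.
by rewrite mulrC ler_pM ?exprn_ge0 ?lerDl// exprS ler_piMr// exprn_ile1.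
Qed.

Lemma two_cubes_approx (R : realType) (S : set place) (s : seq prime_nat)
    (y d : prime_nat -> rat) (x e : R) :
  S !=set0 -> (forall p, p \in s -> ~ S (Finite p)) ->
  (forall p, 0 < d p) -> 0 < e ->
  exists r : rat, [/\ sums_of_two_cubes r,
    forall p, p \in s -> padic_norm p (y p - r) < d p,
    forall q, q \notin s -> ~ S (Finite q) -> padic_norm q r <= 1 &
    ~ S Infinite -> `|x - ratr r| < e].
Proof.
move=> S0 sS d0 e0; have e20 : 0 < e / 2 by rewrite divr_gt0.
have [r [rs rn re]] := strong_approx y x S0 sS d0 e20.
have [f f0 fe] : exists2 f : rat, 0 < f & ratr f < e / 2 :> R.
  have [f] := rat_in_itvoo e20; rewrite in_itv/= => /andP[f0 fe].
  by exists f => //; rewrite -(@ltr0q R).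
(* [C] is kept abstract, with its integrality where [r] is integral, so that
   the numeral is never computed with. *)
have [C CE C1] : exists2 C : rat, C = 432 * r ^+ 3 &
    forall q, padic_norm q r <= 1 -> padic_norm q C <= 1.
  exists (432 * r ^+ 3); first exact: erefl.
  move=> q rq; rewrite padic_normM padic_normX.
  have := padic_norm_nat_le1 q 432; move: (432%:R) => c c1.
  by rewrite mulr_ile1 ?exprn_ge0 ?exprn_ile1 ?padic_norm_ge0.
pose d' p := Num.min 1 (d p / (padic_norm p C + 1)).
have Cp p : 0 < padic_norm p C + 1 by rewrite ltr_wpDl ?padic_norm_ge0.
have d'0 p : 0 < d' p by rewrite lt_min ltr01 divr_gt0.
have CR1 : 0 < `|C| + 1 by rewrite ltr_wpDl.
have e'0 : 0 < Num.min 1 (f / (`|C| + 1)) by rewrite lt_min ltr01 divr_gt0.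
have [w [w0 ws wn we]] := small_rat S0 sS d'0 e'0.
exists (r + C * w ^+ 6); split=> [|p ps|q qs Sq|Soo].
- by rewrite CE; exact: sum_two_cubes_near.
- rewrite opprD addrA; apply: padic_normB_lt; first exact: rs.
  rewrite padic_normM padic_normX.
  exact: mul_expr_lt (padic_norm_ge0 p w) (padic_norm_ge0 p C) (ws p ps).
- apply: le_trans (padic_normD _ _ _) _; rewrite ge_max (rn q qs Sq) andTb.
  rewrite padic_normM padic_normX.
  have := C1 q (rn q qs Sq); have := wn q Sq.
  move: (padic_norm_ge0 q w) (padic_norm_ge0 q C).
  move: (padic_norm q w) (padic_norm q C) => a b a0 b0 a1 b1.
  by rewrite mulr_ile1 ?exprn_ge0 ?exprn_ile1.
- have : `|C * w ^+ 6| < f.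
    rewrite normrM normrX.
    exact: mul_expr_lt (normr_ge0 w) (normr_ge0 C) (we Soo).
  rewrite -(@ltr_rat R) ratr_norm => Cf.
  rewrite rmorphD opprD addrA; apply: le_lt_trans (ler_normB _ _) _.
  rewrite [ltRHS]splitr; apply: ltrD; first exact: re.
  exact: lt_trans Cf fe.
Qed.

End RationalApproximation.

(** * Neighbourhoods in a restricted product *)

(** A neighbourhood of [x] contains a box whose factors are neighbourhoods of
    the [x i] and contain [Z i] for almost all [i].  No openness of the [Z i]
    is assumed, so a factor may be larger than [Z i] at infinitely many
    indices. *)
Lemma restricted_product_open_box (I : Type) (K : I -> topologicalType)
    (Z : forall i, set (K i)) (O : set (restricted_product Z))
    (x : restricted_product Z) :
  open O -> O x -> exists U : forall i, set (K i),
    [/\ forall i, nbhs (val x i) (U i), finite_set [set i | ~ (Z i `<=` U i)] &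
        restricted_box U `<=` O].
Proof.
move=> [D DO <-] [A DA Ax].
have [s sD sA] := DO _ DA; move: Ax; rewrite /= -sA => Ax.
exists (fun i => \bigcap_(V in [set` s]) V i); split.
- move=> i; apply: filter_bigI => V sV; apply: open_nbhs_nbhs; split.
    by have /set_mem[] := sD _ sV.
  exact: (Ax V sV i).
- apply: (@sub_finite_set _ _ (\bigcup_(V in [set` s]) [set i | V i <> Z i])).
    move=> i; apply: contra_notP => sZ z Zz V sV.
    by have [->//|VZ] := pselect (V i = Z i); case: sZ; exists V.
  apply: bigcup_finite => // V sV.
  by have /set_mem[] := sD _ sV.
- move=> y Uy; exists A => //; rewrite -sA => V sV i; exact: (Uy i V sV).
Qed.

(** * Density of the rationals in the p-adic numbers *)

Section PadicDense.
Variable p : prime_nat.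
Local Open Scope ring_scope.
Local Open Scope quotient_scope.

Let padic_cst_cauchy (r : rat) : padic_cauchy p (cst r).
Proof.
by apply/asboolP => e e0; exists 0%N => m n _ _; rewrite subrr padic_norm0.
Qed.

Let padic_cst_seq (r : rat) : padic_seq p := exist _ (cst r) (padic_cst_cauchy r).

(** The class of the constant sequence [r].  It is a ring morphism, and hence
    coincides with [ratr]. *)
Definition padic_cst (r : rat) : padic p := \pi_(padic p) (padic_cst_seq r).

Let padic_cst_zmod_morphism : zmod_morphism padic_cst.
Proof.
by move=> x y; rewrite /padic_cst -rmorphB; congr (\pi _); exact/val_inj.
Qed.

Let padic_cst_monoid_morphism : monoid_morphism padic_cst.
Proof.
split=> [|x y]; rewrite /padic_cst -?(rmorph1 (\pi_(padic p))) -?rmorphM.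
  by congr (\pi _); exact/val_inj.
by congr (\pi _); exact/val_inj.
Qed.

HB.instance Definition _ :=
  GRing.isZmodMorphism.Build rat (padic p) padic_cst padic_cst_zmod_morphism.
HB.instance Definition _ :=
  GRing.isMonoidMorphism.Build rat (padic p) padic_cst padic_cst_monoid_morphism.

Lemma padic_cstE (r : rat) : padic_cst r = ratr r.
Proof. exact: (fmorph_eq_rat padic_cst). Qed.

Lemma padic_rat_dense (x : padic p) (d : rat) : 0 < d ->
  exists y : rat, padic_abs (x - ratr y) < d.
Proof.
move=> d0; have [N uN] := padic_seqP (repr x) d0.
exists (val (repr x) N).
rewrite -padic_cstE -[x in x - _]padic_reprE /padic_cst -rmorphB /=.
set w := _ - _; have [/andP[_ /eqP->//]|[_ [M wM]]] := padic_absP w.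
by rewrite -(wM _ (leq_maxr N M)); apply: uN; rewrite ?leq_maxl.
Qed.

Lemma padic_ball_ratr (x : padic p) (y r d : rat) :
  padic_abs (x - ratr y) < d -> padic_norm p (y - r) < d -> ball x d (ratr r).
Proof.
move=> xy yr; rewrite ballEmdist; change (padic_abs (x - ratr r) < d).
rewrite -[x - _](subrKA (ratr y)); apply: le_lt_trans (padic_absD _ _) _.
by rewrite gt_max xy -!padic_cstE -rmorphB /= padic_cstE padic_abs_ratr.
Qed.

End PadicDense.

(** * Density of the sums of two cubes *)

Theorem proposition1p22 (R : realType) (S : set place) (S_neq0 : S !=set0) :
  dense (adele_diag R S @` sums_of_two_cubes).
Proof.
move=> O [x Ox] oO.
have [U [nU fU UO]] := restricted_product_open_box oO Ox.
(* [g] sends a finite place to its prime; the value 2 at the infinite place is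
   arbitrary.  It may add the prime 2 to [s], which only asks for one more
   approximation. *)
pose g (v : ~` S) : prime_nat :=
  match val v with Infinite => exist _ 2 isT | Finite p => p end.
have /finite_seqP[s0 s0E] := finite_image g fU.
pose s := [seq p <- s0 | Finite p \in ~` S].
have sS p : p \in s -> ~ S (Finite p).
  by rewrite mem_filter => /andP[/set_mem].
have nearp p : exists yd : rat * rat, (0 < yd.2)%R /\
    forall (h : Finite p \in ~` S) (r : rat),
      (padic_norm p (yd.1 - r) < yd.2)%R -> U (exist (fun u => u \in ~` S) _ h) (ratr r).
  have [h|h] := pselect (Finite p \in ~` S); last first.
    by exists (0, 1)%R; split=> // h'; case: h.
  pose v : ~` S := exist (fun u => u \in ~` S) _ h.
  have /(@nbhs_ballP rat (padic p))[d /= d0 dU] := nU v.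
  have [y yd] := padic_rat_dense (val x v) d0.
  exists (y, d); split=> //= h' r yr.
  rewrite (bool_irrelevance h' h); apply: dU.
  exact: padic_ball_ratr yd yr.
have [yd ydP] := choice nearp.
have [xe [e [e0 eP]]] : exists (xe : R) (e : R), (0 < e)%R /\
    forall (h : Infinite \in ~` S) (r : rat),
      (`|xe - ratr r| < e)%R -> U (exist (fun u => u \in ~` S) _ h) (ratr r).
  have [h|h] := pselect (Infinite \in ~` S); last first.
    by exists 0%R, 1%R; split=> // h'; case: h.
  pose v : ~` S := exist (fun u => u \in ~` S) _ h.
  have /(@nbhs_ballP R R)[d /= d0 dU] := nU v.
  exists (val x v), d; split=> // h' r xr.
  by rewrite (bool_irrelevance h' h); apply: dU.
have [r [rC rs rn roo]] := two_cubes_approx (fun p => (yd p).1) xe S_neq0 sS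
  (fun p => proj1 (ydP p)) e0.
exists (adele_diag R S r); split; last by exists r.
apply: UO => -[[|p] h] /=.
  by apply: eP; apply: roo; exact: (set_mem h).
have nS : ~ S (Finite p) := set_mem h.
have [ps|ps] := boolP (p \in s); first exact: (proj2 (ydP p)) (rs p ps).
have ZU : completion_int (R:=R) (v:=Finite p) `<=` U (exist (fun u => u \in ~` S) _ h).
  apply: contrapT => nZU; move: ps; rewrite mem_filter h /= => /negP; apply.
  have : [set` s0] p by rewrite -s0E; exists (exist (fun u => u \in ~` S) _ h).
  by [].
apply: ZU; rewrite /completion_int /= /padic_int /= padic_abs_ratr.
exact: rn.
Qed.
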